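(* Let $k,N\in\mathbb{N}$. Let $\mathbf n=(n_1,\ldots,n_k)$ be a multi-index of order $k$ such that $|\mathbf n|=2N$. Let $A^{(i)}\in V_{n_i}$, $i=1,\ldots,k$, be symmetric $(0,n_i)$-tensors. Then $$\tau^N\left(A^{(1)}\vee\ldots\vee A^{(k)}\right)=\sum_{\Gamma\in\mathfrak G(\mathbf n)}c(\Gamma)\,T(\varphi_\Gamma),$$ where $\varphi_\Gamma$ is an arbitrary permutation from the set $H^{-1}(\Gamma)$ and the coefficients $c(\Gamma)$ are given by $$c(\Gamma)=\frac{\mathbf n!}{(|\mathbf n|-1)!!}\cdot\frac{1}{\prod_{1\leqslant i<j\leqslant k}\gamma_{ij}!\ \prod_{1\leqslant i\leqslant k}\gamma_{ii}!!},\qquad \Gamma=(\gamma_{ij}).$$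
   Context: A multi-index $\mathbf n=(n_1,\ldots,n_k)$ of order $k$ is a $k$-tuple of non-negative integers; $|\mathbf n|=n_1+\ldots+n_k$, $\mathbf n!=n_1!\cdots n_k!$. Double factorial: $m!!=m(m-2)(m-4)\cdots$, with $0!!=1$. $V_m$ is the space of symmetric covariant tensors of rank $m$ (on a fixed finite-dimensional real vector space). The symmetrized tensor product is $A\vee B=\mathrm{Sym}(A\otimes B)$, where $\mathrm{Sym}$ is the average over all permutations of indices. $Q$ is a fixed symmetric $(2,0)$-tensor, and $\tau:V_{m+2}\to V_m$ is contraction with $Q$: $(\tau A)_{\nu_1\ldots\nu_m}=Q^{\alpha\beta}A_{\alpha\beta\nu_1\ldots\nu_m}$ (repeated indices summed). For a permutation $\varphi\in S_{2N}$, $$T(\varphi)=Q^{\nu_1\nu_2}Q^{\nu_3\nu_4}\cdots Q^{\nu_{2N-1}\nu_{2N}}\left(A^{(1)}\otimes\ldots\otimes A^{(k)}\right)_{\nu_{\varphi(1)}\ldots\nu_{\varphi(2N)}}.$$ $\mathfrak G(\mathbf n)$ is the set of symmetric $k\times k$ matrices $\Gamma=(\gamma_{ij})$ with non-negative integer entries, even diagonal entries $\gamma_{ii}$, and row sums $\sum_{j=1}^k\gamma_{ij}=n_i$ for all $i$ (adjacency matrices of multigraphs on $k$ distinct vertices of degrees $n_i$, each self-loop counted twice on the diagonal). The map $H:S_{2N}\to\mathfrak G(\mathbf n)$ assigns to $\varphi$ the matrix recording how the tensors are contracted in $T(\varphi)$: for $i\neq j$, $\gamma_{ij}$ is the number of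 factors $Q^{\nu_{2l-1}\nu_{2l}}$ that contract an index of $A^{(i)}$ with an index of $A^{(j)}$, and $\gamma_{ii}$ is twice the number of factors $Q^{\nu_{2l-1}\nu_{2l}}$ both of whose indices are contracted with indices of $A^{(i)}$. *)

(* Defs.v *)
From mathcomp Require Import all_boot all_order all_algebra all_fingroup.
From mathcomp Require Import classical_sets cardinality fsbigop reals.

Set Implicit Arguments.
Unset Strict Implicit.
Unset Printing Implicit Defensive.

Import Order.TTheory GRing.Theory Num.Theory.

Local Open Scope ring_scope.

(* (0,m)-tensors on a d-dimensional real vector space, given by their
   components in a fixed basis; indices and slots are numbered from 0. *)
Definition tensor (R : realType) (d m : nat) := {ffun m.-tuple 'I_d -> R}.

Section Tensors.
Variables (R : realType) (d : nat).
Local Notation tensor := (tensor R d).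

(* (nu_{s(1)}, ..., nu_{s(m)}) *)
Definition reindex m (s : 'S_m) (nu : m.-tuple 'I_d) : m.-tuple 'I_d :=
  [tuple tnth nu (s i) | i < m].

(* membership in V_m *)
Definition symmetric_tensor m (A : tensor m) : Prop :=
  forall (s : 'S_m) nu, A (reindex s nu) = A nu.

Definition Sym m (A : tensor m) : tensor m :=
  [ffun nu => (m`!)%:R^-1 * \sum_(s : 'S_m) A (reindex s nu)].

Definition tens m p (A : tensor m) (B : tensor p) : tensor (m + p) :=
  [ffun nu => A [tuple tnth nu (lshift p i) | i < m]
            * B [tuple tnth nu (rshift m i) | i < p]].

Definition vee m p (A : tensor m) (B : tensor p) : tensor (m + p) :=
  Sym (tens A B).

Definition tensor_cast m p (e : m = p) (A : tensor m) : tensor p :=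
  [ffun nu => A (tcast (esym e) nu)].

(* A^(1) (x) ... (x) A^(k): the slots are split into consecutive blocks of
   lengths n_1, ..., n_k, and [tagnat.Rank i j] is the j-th slot of block i. *)
Definition tens_fam k (n : 'I_k -> nat) (A : forall i, tensor (n i)) :
    tensor (\sum_(i < k) n i)%N :=
  [ffun nu => \prod_(i < k) A i [tuple tnth nu (tagnat.Rank i j) | j < n i]].

(* The iterated product A^(1) \/ ... \/ A^(k) multiplies tensors of varying
   rank, so it is computed on pairs (rank, tensor); the empty product is the
   scalar 1. *)
Definition gvee (X Y : {m : nat & tensor m}) : {m : nat & tensor m} :=
  Tagged tensor (vee (tagged X) (tagged Y)).

Definition gone : {m : nat & tensor m} :=
  Tagged tensor ([ffun=> 1] : tensor 0).

Definition gvee_fam k (n : 'I_k -> nat) (A : forall i, tensor (n i)) :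
    {m : nat & tensor m} :=
  \big[gvee/gone]_(i < k) Tagged tensor (A i).

Lemma rank_gvee_fam k (n : 'I_k -> nat) (A : forall i, tensor (n i)) :
  tag (gvee_fam A) = (\sum_(i < k) n i)%N.
Proof. exact: (big_morph (fun X : {m : nat & tensor m} => tag X)). Qed.

Definition vee_fam k (n : 'I_k -> nat) (A : forall i, tensor (n i)) :
    tensor (\sum_(i < k) n i)%N :=
  tensor_cast (rank_gvee_fam A) (tagged (gvee_fam A)).

Definition tau (Q : 'M[R]_d) m (A : tensor m.+2) : tensor m :=
  [ffun nu : m.-tuple 'I_d =>
    \sum_(a < d) \sum_(b < d) Q a b * A [tuple of a :: b :: nu]].

(* tau^N : V_{2N} -> V_0 *)
Fixpoint tau_iter (Q : 'M[R]_d) (N : nat) : tensor N.*2 -> tensor 0 :=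
  match N with
  | 0 => id
  | N'.+1 => fun A : tensor N'.*2.+2 => tau_iter Q (tau Q A)
  end.

Definition scalar_of (A : tensor 0) : R := A [tuple].

End Tensors.

(* With 0-based numbering the l-th factor Q carries the indices nu_{2l} and
   nu_{2l+1}. *)
Definition Qfst N (l : 'I_N) : 'I_(N.*2) :=
  Ordinal (etrans (ltn_double l N) (ltn_ord l)).

Definition Qsnd N (l : 'I_N) : 'I_(N.*2) :=
  Ordinal (etrans (ltn_Sdouble l N) (ltn_ord l)).

Definition contraction (R : realType) (d : nat) (Q : 'M[R]_d) (k N : nat)
    (n : 'I_k -> nat) (hn : (\sum_(i < k) n i)%N = N.*2)
    (A : forall i, tensor R d (n i)) (phi : 'S_(N.*2)) : R :=
  \sum_(nu : (N.*2).-tuple 'I_d)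
    (\prod_(l < N) Q (tnth nu (Qfst l)) (tnth nu (Qsnd l)))
    * tensor_cast hn (tens_fam A) (reindex phi nu).

Definition multigraphs k (n : 'I_k -> nat) : set 'M[nat]_k :=
  [set G | [/\ G^T%R = G,
               forall i, ~~ odd (G i i)
             & forall i, (\sum_(j < k) G i j)%N = n i]]%classic.

Lemma finite_multigraphs k (n : 'I_k -> nat) : finite_set (multigraphs n).
Proof.
pose m := (\sum_(i < k) n i)%N.
pose f (M : 'M['I_m.+1]_k) : 'M[nat]_k := map_mx (@nat_of_ord _) M.
apply: (@sub_finite_set _ _ (f @` [set: 'M['I_m.+1]_k])%classic); last first.
  by apply: finite_image; exact: finite_finset.
move=> G [_ _ rowG]; exists (map_mx inord G) => //.
apply/matrixP => i j; rewrite !mxE inordK // ltnS /m.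
rewrite (bigD1 i) //= -(rowG i) (bigD1 j) //= -addnA; exact: leq_addr.
Qed.

(* In T(phi) = [contraction Q hn A phi], slot s of A^(1) (x) ... (x) A^(k)
   carries the index nu_{phi(s)}; hence nu_p sits in slot phi^{-1}(p). *)
Definition vertex (k N : nat) (n : 'I_k -> nat)
    (hn : (\sum_(i < k) n i)%N = N.*2) (phi : 'S_(N.*2)) (p : 'I_(N.*2)) : 'I_k :=
  tagnat.sig1 (cast_ord (esym hn) ((phi^-1)%g p)).

Definition contraction_graph (k N : nat) (n : 'I_k -> nat)
    (hn : (\sum_(i < k) n i)%N = N.*2) (phi : 'S_(N.*2)) : 'M[nat]_k :=
  let u l := vertex hn phi (Qfst l) in
  let v l := vertex hn phi (Qsnd l) in
  \matrix_(i < k, j < k)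
    if i == j then (2 * #|[set l : 'I_N | (u l == i) && (v l == i)]%SET|)%N
    else #|[set l : 'I_N | (u l == i) && (v l == j)
                        || (u l == j) && (v l == i)]%SET|.

(* double factorial m!!, with 0!! = 1 *)
Fixpoint dfact (m : nat) : nat :=
  match m with
  | m'.+2 => (m'.+2 * dfact m')%N
  | _ => 1%N
  end.

(* For |n| = 0, [(|n|).-1 = 0], which yields the usual (-1)!! = 1. *)
Definition multigraph_coef (R : realType) k (n : 'I_k -> nat) (G : 'M[nat]_k) : R :=
  (\prod_(i < k) (n i)`!)%N%:R / (dfact (\sum_(i < k) n i)%N.-1)%:R
  * (1 / ((\prod_(i < k) \prod_(j < k | (i < j)%N) (G i j)`!)
          * \prod_(i < k) dfact (G i i))%N%:R).

(* Main.v *)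
(* Nested symmetrizations collapse into a single one, so the left-hand side is
   the average of T over S_2N.  As the A^(i) are symmetric, T(phi) depends only
   on the word of N ordered pairs of vertices joined by the successive factors
   Q; as Q is symmetric too, it depends only on the multiset of unordered pairs,
   i.e. on H(phi).  Hence the left-hand side is the sum over Gamma of
   |H^-1(Gamma)| / (2N)! T(phi_Gamma).  A word comes from n! permutations, and
   the words with graph Gamma number N! / prod_e m_e! (m_e the multiplicity of
   the edge e), times 2 for each edge that is not a loop; conclude with
   (2m)!! = 2^m m! and (2N)! = (2N)!! (2N-1)!!. *)
Require Import Defs.
From mathcomp Require Import all_boot all_order all_algebra all_fingroup.
From mathcomp Require Import classical_sets fsbigop reals.
From mathcomp Require Import cardinality finmap.

Set Implicit Arguments.
Unset Strict Implicit.
Unset Printing Implicit Defensive.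

Import GRing.Theory Num.Theory.

Local Open Scope nat_scope.

(** * Permutations and functions with prescribed fibers *)

Lemma card_permT (T : finType) : #|{: {perm T}}| = #|T| `!.
Proof.
rewrite -cardsT -card_perm; apply: eq_card => s.
have sT : perm_on [set: T]%SET s.
  by apply/fintype.subsetP => t; rewrite finset.in_setT.
by symmetry; exact: sT.
Qed.

(** Induction on the word: the first letter [a] lifts to any [y] of [A] in its fibre, and the other
    letters are then lifted avoiding [y], which lowers only the falling factorial at [a]. *)
Lemma card_uniq_lifts (T X : finType) (g : T -> X) (A : pred T) n
    (w : n.-tuple X) :
  #|[set t : n.-tuple T | [&& all A t, uniq t & map g t == w :> seq X]]%SET| =
  \prod_x #|[predI A & [pred t | g t == x]]| ^_ count_mem x w.
Proof.
elim: n A w => [|n IHn] A w.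
  rewrite [w]tuple0 big1 // (@fintype.eq_card1 _ [tuple]) // => t.
  by rewrite [t]tuple0 inE.
case/tupleP: w => a w.
rewrite -sum1dep_card
  (partition_big (@thead _ _) [predI A & [pred t | g t == a]]) /=; last first.
  move=> t; case/tupleP: t => y t /=.
  rewrite theadE => /and3P[/andP[Ay _] _ /eqP[<- _]].
  by apply/andP; split; [exact: Ay | exact: eqxx].
rewrite (bigD1 a) //= eqxx ffactnS -mulnA -sum_nat_const.
apply: eq_bigr => y /andP[Ay]; rewrite [y \in _]/= => gy.
have Agy : y \in [predI A & [pred t | g t == a]] by apply/andP.
rewrite (cardD1 y) Agy add1n succnK.
have {}gy : g y == a by exact: gy.
have := IHn [predD1 A & y] w; rewrite (bigD1 a) //= => IH.
transitivity (\sum_(t : n.-tuple T | [&& all [predD1 A & y] t, uniq t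
                                       & map g t == w :> seq X]) 1).
  rewrite (reindex (fun t : n.-tuple T => [tuple of y :: t])) /=; last first.
    exists (fun t : n.+1.-tuple T => [tuple of behead t]).
      by move=> t _; apply: val_inj.
    by move=> t /andP[_ /eqP <-]; rewrite -tuple_eta.
  apply: eq_bigl => t; rewrite theadE eqxx andbT [A y]Ay /=.
  rewrite eqseq_cons gy /= all_predI all_predC has_pred1.
  by case: (y \in t); rewrite ?andbF //= !andbA.
rewrite sum1dep_card IH; congr (_ * _).
  by congr (_ ^_ _); apply: eq_card => t; rewrite !inE andbA.
apply: eq_bigr => x xa; rewrite eq_sym (negbTE xa); congr (_ ^_ _).
apply: eq_card => t; rewrite !inE; case: eqP => //= -> .
by rewrite (eqP gy) eq_sym (negbTE xa) andbF.
Qed.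

(** A permutation is the duplicate-free word of its values, so these are the lifts along [g] of the
    word of [f]; equal fibre sizes turn the falling factorials into factorials. *)
Lemma card_perm_intertwining (T X : finType) (f g : T -> X) :
  (forall x, #|[pred t | f t == x]| = #|[pred t | g t == x]|) ->
  #|[set s : {perm T} | [forall t, g (s t) == f t]]%SET| =
  \prod_x #|[pred t | f t == x]| `!.
Proof.
move=> fg.
transitivity #|[set t : tuple_of #|T| T | [&& all predT t, uniq t &
  map g t == map_tuple f (enum_tuple T) :> seq X]]%SET|; last first.
  rewrite card_uniq_lifts; apply: eq_bigr => x _.
  have -> : #|[predI predT & [pred t | g t == x]]| = #|[pred t | f t == x]|.
    by rewrite fg; apply: eq_card.
  suff -> : count_mem x (map f (enum T)) =
            #|[pred t | f t == x]| by rewrite ffactnn.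
  by rewrite count_map enumT cardE size_filter; apply: eq_count.
pose h (s : {perm T}) : tuple_of #|T| T := map_tuple s (enum_tuple T).
have h_inj : injective h.
  move=> s s' /(congr1 val) /= hs; apply/permP => t.
  by apply: (eq_in_map _ _ _).2; [exact: hs | rewrite /= mem_enum].
rewrite -(card_imset _ h_inj); apply: eq_card => t.
rewrite [RHS]inE all_predT /=; apply/finset.imsetP/andP => [[s]|[ut /eqP gt]].
  rewrite inE => /forallP gs ->; split.
    by rewrite map_inj_uniq ?enum_uniq //; apply: perm_inj.
  by apply/eqP; rewrite -map_comp; apply: eq_map => i; apply/eqP/gs.
pose u i := tnth t (enum_rank i).
have u_inj : injective u by move=> i j /(tuple_uniqP _ ut) /enum_rank_inj.
have tE : t = h (perm u_inj).
  apply: eq_from_tnth => i; rewrite tnth_map permE /u.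
  rewrite (tnth_nth (enum_val i) (enum_tuple _)).
  by rewrite -(enum_val_nth (enum_val i)) enum_valK.
exists (perm u_inj) => //; rewrite inE; apply/forallP => i.
move: gt; rewrite tE /= -map_comp => /eq_in_map /(_ i).
by rewrite mem_enum /= => ->.
Qed.

Lemma exists_perm_intertwining (T X : finType) (f g : T -> X) :
  (forall x, #|[pred t | f t == x]| = #|[pred t | g t == x]|) ->
  exists s : {perm T}, forall t, g (s t) = f t.
Proof.
move=> fg.
have : 0 < #|[set s : {perm T} | [forall t, g (s t) == f t]]%SET|.
  by rewrite card_perm_intertwining // prodn_gt0 // => x; apply: fact_gt0.
by case/card_gt0P => s; rewrite inE => /forallP gs; exists s => t; apply/eqP.
Qed.

Lemma exists_ffun_fibers (T X : finType) (m : X -> nat) :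
  \sum_x m x = #|T| ->
  exists f : {ffun T -> X}, forall x, #|[pred t | f t == x]| = m x.
Proof.
(* [c] lists each [x] exactly [m x] times; read along the enumeration of [T], it is the function
   sought. *)
move=> mT; pose c := flatten [seq nseq (m x) x | x <- enum X].
have sc : size c == #|T|.
  rewrite size_flatten /shape -map_comp -mT sumnE big_map big_enum /=.
  by apply/eqP/eq_bigr => x _; rewrite size_nseq.
exists [ffun t => tnth (Tuple sc) (enum_rank t)] => x.
transitivity #|[pred i | tnth (Tuple sc) i == x]|.
  rewrite -(fintype.card_image enum_rank_inj); apply: eq_card => i.
  rewrite [RHS]inE; apply/fintype.imageP/idP => [[t]|ti].
    by rewrite inE ffunE => tx ->.
  by exists (enum_val i); rewrite ?inE ?ffunE ?enum_valK.
transitivity (count_mem x c).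
  rewrite -[c]/(tval (Tuple sc)) -[in RHS](map_tnth_enum (Tuple sc)).
  by rewrite count_map enumT cardE size_filter; apply: eq_count.
rewrite count_flatten -map_comp sumnE big_map big_enum /= (bigD1 x) //=.
rewrite count_nseq /= eqxx mul1n big1 ?addn0 // => y yx.
by rewrite count_nseq /= (negbTE yx).
Qed.

(** The multinomial coefficient, cleared of denominators: each such [f] is a fixed [f0] precomposed
    with a permutation, in as many ways as the product of the factorials of the [m x]. *)
Lemma card_ffun_fibers (T X : finType) (m : X -> nat) :
  \sum_x m x = #|T| ->
  #|[set f : {ffun T -> X} | [forall x, #|[pred t | f t == x]| == m x]]%SET|
    * \prod_x (m x)`! = #|T| `!.
Proof.
move=> mT; have [f0 f0m] := exists_ffun_fibers mT.
pose F := [set f : {ffun T -> X} |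
  [forall x, #|[pred t | f t == x]| == m x]]%SET.
have -> : #|T| `! = \sum_(s : {perm T}) 1 by rewrite sum1_card card_permT.
rewrite (partition_big (fun s : {perm T} => [ffun t => f0 (s t)])
  (fun f => f \in F)) /=.
  rewrite -sum_nat_const; apply: eq_bigr => f; rewrite inE => /forallP fm.
  rewrite sum1dep_card.
  rewrite (eq_card (B := [set s : {perm T} | [forall t, f0 (s t) == f t]]%SET)).
    rewrite card_perm_intertwining => [|x]; last by rewrite f0m (eqP (fm x)).
    by apply: eq_bigr => x _; rewrite (eqP (fm x)).
  move=> s; rewrite !inE; apply/eqP/forallP => [<- t|fs]; first by rewrite ffunE.
  by apply/ffunP => t; rewrite ffunE (eqP (fs t)).
move=> s _; rewrite inE; apply/forallP => x; rewrite -f0m.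
rewrite -[X in _ == X](on_card_preimset (f := s)) //.
  by rewrite cardsE; apply/eqP/eq_card => t; rewrite !inE ffunE.
by apply: onW_bij; exists (s^-1)%g; [apply: permK | apply: permKV].
Qed.

(** * Words of vertex pairs and their multigraphs *)

Lemma dfact_double m : dfact m.*2 = 2 ^ m * m`!.
Proof.
elim: m => [|m IHm] //; rewrite doubleS [dfact _]/(m.*2.+2 * dfact m.*2).
by rewrite IHm -doubleS -mul2n factS expnS mulnACA.
Qed.

Lemma fact_dfact m : m`! = dfact m * dfact m.-1.
Proof.
elim: m => [|[|m] IHm] //; rewrite factS IHm mulnCA [RHS]mulnC.
by congr (_ * _).
Qed.

Lemma prod_fiber (T X : finType) (f : T -> X) (w : X -> nat) :
  \prod_t w (f t) = \prod_x w x ^ #|[pred t | f t == x]|.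
Proof.
rewrite (partition_big f predT) //=; apply: eq_bigr => x _.
rewrite (eq_bigr (fun=> w x)) => [|t /eqP -> //].
by rewrite prod_nat_const.
Qed.

Section PairGraph.
Variable k : nat.
Implicit Types x y : 'I_k * 'I_k.

(** Edges, loops included, are encoded as pairs with [x.1 <= x.2]; sorting forgets the
    orientation. *)
Definition sort_pair x := if x.1 <= x.2 then x else (x.2, x.1).

Lemma sort_pair_le x : (sort_pair x).1 <= (sort_pair x).2.
Proof. by rewrite /sort_pair; case: (leqP x.1 x.2) => [|/ltnW]. Qed.

Lemma sort_pair_id x : x.1 <= x.2 -> sort_pair x = x.
Proof. by rewrite /sort_pair => ->. Qed.

Lemma sort_pairC (i j : 'I_k) : sort_pair (i, j) = sort_pair (j, i).
Proof.
by rewrite /sort_pair /=; case: ltngtP => // /val_inj ->.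
Qed.

Lemma sort_pair_eq (u v i j : 'I_k) :
  (sort_pair (u, v) == sort_pair (i, j)) =
  (u == i) && (v == j) || (u == j) && (v == i).
Proof.
apply/eqP/idP => [|/orP[]/andP[/eqP-> /eqP->] //]; last exact: sort_pairC.
by rewrite /sort_pair /=; do 2!case: ifP => _; case=> -> ->; rewrite !eqxx ?orbT.
Qed.

Lemma card_sort_pair x : x.1 <= x.2 ->
  #|[pred y | sort_pair y == x]| = (x.1 != x.2).+1.
Proof.
case: x => i j /= ij; rewrite -[(i, j)]sort_pair_id //.
transitivity #|pred2 (i, j) (j, i)|; last by rewrite card2 xpair_eqE (eq_sym j) andbb.
by apply: eq_card => -[u v]; rewrite !inE sort_pair_eq !xpair_eqE.
Qed.

Variable N : nat.
Implicit Types f : 'I_N -> 'I_k * 'I_k.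

(** The multigraph of a word of ordered pairs; the factor [(i == j).+1] counts loops twice. *)
Definition pair_graph f : 'M[nat]_k :=
  \matrix_(i, j) ((i == j).+1 * #|[pred l | sort_pair (f l) == sort_pair (i, j)]|).

Lemma row_pair_graph f i :
  \sum_j pair_graph f i j = \sum_l (((f l).1 == i) + ((f l).2 == i)).
Proof.
(* Letter by letter, count the orientations in which the letter is [(i, j)]; on the diagonal both
   match, which gives the factor 2. *)
transitivity (\sum_j \sum_l (((f l).1 == i) * ((f l).2 == j)
                             + ((f l).1 == j) * ((f l).2 == i))).
  apply: eq_bigr => j _; rewrite mxE -sum1_card big_mkcond big_distrr /=.
  apply: eq_bigr => l _; rewrite inE; case: (f l) => u v /=; rewrite sort_pair_eq.
  have [<-|ij] := eqVneq i j; first by do 2!case: eqP.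
  have [->|ui] := eqVneq u i; last by case: (u == j); case: (v == i).
  by rewrite (negbTE ij) /= orbF; case: (v == j).
rewrite exchange_big; apply: eq_bigr => l _; rewrite big_split /=.
congr (_ + _); last first.
  rewrite (bigD1 (f l).1) //= eqxx mul1n big1 ?addn0 // => j.
  by rewrite eq_sym => /negbTE ->.
rewrite (bigD1 (f l).2) //= eqxx muln1 big1 ?addn0 // => j.
by rewrite eq_sym => /negbTE ->; rewrite muln0.
Qed.

(* For i <= j, the number of edges {i, j}: a loop counts twice on the diagonal. *)
Definition edge_mult (G : 'M[nat]_k) x :=
  if x.1 <= x.2 then G x.1 x.2 %/ (x.1 == x.2).+1 else 0.

(** Symmetry leaves only the entries with [i <= j], and even diagonal entries make the division in
    [edge_mult] exact. *)
Lemma pair_graphP (n : 'I_k -> nat) (G : 'M[nat]_k) f : multigraphs n G ->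
  (pair_graph f == G) =
  [forall x, #|[pred l | sort_pair (f l) == x]| == edge_mult G x].
Proof.
case=> symG evenG _; apply/eqP/forallP => [<- x|fG]; last first.
  have fGle (i j : 'I_k) : i <= j -> pair_graph f i j = G i j.
    move=> ij; rewrite mxE sort_pair_id // (eqP (fG (i, j))) /edge_mult /= ij.
    have [<-|_] := eqVneq i j; last by rewrite mul1n divn1.
    by rewrite mulnC divnK // dvdn2.
  apply/matrixP => i j; have [/fGle //|/ltnW/fGle ji] := leqP i j.
  by rewrite -symG [RHS]mxE -ji !mxE eq_sym sort_pairC.
rewrite /edge_mult; case: ifP => xs.
  by rewrite mxE -surjective_pairing sort_pair_id // mulKn.
(* A pair with [x.1 > x.2] is never sorted, so no letter is counted there. *)
rewrite -leqn0 leqNgt; apply/card_gt0P => -[l]; rewrite inE => /eqP lx.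
by rewrite -lx sort_pair_le in xs.
Qed.

(** Handshake argument: the entries of [G] sum to 2N and see every edge twice. Doubling once more
    makes the identity symmetric in [i] and [j], so that it can be checked entry by entry. *)
Lemma sum_edge_mult (n : 'I_k -> nat) (G : 'M[nat]_k) : multigraphs n G ->
  \sum_i n i = N.*2 -> \sum_x edge_mult G x = N.
Proof.
case=> symG evenG rowG nN; apply: double_inj; apply: double_inj.
have e2 i j : (edge_mult G (i, j)).*2 + (edge_mult G (j, i)).*2 = G i j + G j i.
  have Gji : G j i = G i j by rewrite -[in LHS]symG mxE.
  have [ij|ij] := eqVneq i j.
    by rewrite -ij /edge_mult /= leqnn eqxx -!muln2 divnK ?dvdn2.
  rewrite /edge_mult /= Gji [j == i]eq_sym (negbTE ij) !divn1.
  case: ltngtP => [_|_|/val_inj/eqP]; last by rewrite (negbTE ij).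
    by rewrite addn0 addnn.
  by rewrite addnn.
have -> : N.*2 = \sum_i \sum_j G i j.
  by rewrite -nN; apply: eq_bigr => i _; rewrite rowG.
transitivity ((\sum_i \sum_j edge_mult G (i, j)).*2.*2).
  by rewrite pair_bigA; do 2!congr double; apply: eq_bigr => -[].
have sumC (h : 'I_k -> 'I_k -> nat) :
    \sum_i \sum_j (h i j + h j i) = (\sum_i \sum_j h i j).*2.
  rewrite -addnn [X in _ = _ + X]exchange_big -big_split.
  by apply: eq_bigr => i _; rewrite -big_split.
rewrite -[RHS]sumC; under [RHS]eq_bigr do under eq_bigr do rewrite -e2.
rewrite (sumC (fun i j => (edge_mult G (i, j)).*2)) ; congr double.
rewrite -[LHS]muln2 big_distrl; apply: eq_bigr => i _.
by rewrite big_distrl; apply: eq_bigr => j _; rewrite /= muln2.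
Qed.

End PairGraph.

(** A word of ordered pairs is a word of edges together with an orientation of each letter: a
    multinomial coefficient counts the former, [P] the latter. *)
Lemma card_pair_graph k N (n : 'I_k -> nat) (G : 'M[nat]_k) :
    multigraphs n G -> \sum_i n i = N.*2 ->
  #|[set f : {ffun 'I_N -> 'I_k * 'I_k} | pair_graph f == G]%SET|
    * ((\prod_(i < k) \prod_(j < k | i < j) (G i j)`!) * \prod_(i < k) dfact (G i i))
  = N`! * 2 ^ N.
Proof.
move=> GM nN; have sumN := sum_edge_mult GM nN; have [_ evenG _] := GM.
pose w (x : 'I_k * 'I_k) := #|[pred y | sort_pair y == x]|.
have wE (x : 'I_k * 'I_k) : x.1 <= x.2 -> w x = (x.1 != x.2).+1.
  exact: card_sort_pair.
pose P := \prod_x w x ^ edge_mult G x.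
(* For [x.1 > x.2] the factor is 0 ^ 0 = 1. *)
have Ppos : 0 < P.
  rewrite prodn_gt0 // => x; rewrite expn_gt0 /edge_mult.
  case: (leqP x.1 x.2) => [xs|_].
    by rewrite wE.
  by rewrite orbT.
have cardf : #|[set f : {ffun 'I_N -> 'I_k * 'I_k} | pair_graph f == G]%SET|
    * \prod_x (edge_mult G x)`! = N`! * P.
  have sumN' : \sum_x edge_mult G x = #|'I_N| by rewrite card_ord.
  have cardN := congr1 factorial (card_ord N).
  rewrite -(etrans (card_ffun_fibers sumN') cardN) [RHS]mulnAC; congr (_ * _).
  rewrite -[LHS]sum1dep_card.
  rewrite (partition_big
    (fun f : {ffun 'I_N -> 'I_k * 'I_k} => [ffun l => sort_pair (f l)])
    (fun g : {ffun 'I_N -> 'I_k * 'I_k} =>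
       [forall x, #|[pred l | g l == x]| == edge_mult G x])) /=.
    rewrite -sum_nat_cond_const; apply: eq_bigr => g /forallP gG.
    rewrite sum1dep_card.
    (* Above a fixed word of edges [g], the letters are oriented independently. *)
    transitivity #|family (fun l => [pred y | sort_pair y == g l])|.
      apply: eq_card => f; rewrite inE; apply/andP/familyP => [[_ /eqP <-] l|fg].
        by rewrite inE ffunE.
      have fgE : [ffun l => sort_pair (f l)] = g.
        apply/ffunP => l; rewrite ffunE; apply/eqP.
        by have := fg l; rewrite inE.
      rewrite fgE (pair_graphP _ GM); split=> //; apply/forallP => x.
      rewrite -(eqP (gG x)) -fgE; apply/eqP/eq_card => l.
      by rewrite !inE ffunE.
    rewrite card_family foldrE big_map big_enum /= /P.
    rewrite (prod_fiber g w); apply: eq_bigr => x _.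
    by rewrite (eqP (gG x)).
  move=> f; rewrite (pair_graphP _ GM) => /forallP fG; apply/forallP => x.
  by rewrite -(eqP (fG x)); apply/eqP/eq_card => l; rewrite !inE ffunE.
(* Factor by factor: for [i < j] both sides are the factorial of the entry times a power of 2; a
   loop uses (2m)!! = 2^m m!; for [i > j] both sides are 1. *)
have DP : ((\prod_(i < k) \prod_(j < k | i < j) (G i j)`!)
      * \prod_(i < k) dfact (G i i)) * P
    = (\prod_x (edge_mult G x)`!) * 2 ^ N.
  rewrite -(congr1 (expn 2) sumN) expn_sum -[RHS]big_split /P /=.
  transitivity (\prod_(x : 'I_k * 'I_k) ((if x.1 < x.2 then (G x.1 x.2)`! else 1)
      * (if x.1 == x.2 then dfact (G x.1 x.2) else 1) * w x ^ edge_mult G x)).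
    rewrite [RHS]big_split [in RHS]big_split /=; congr (_ * _ * _).
      rewrite -(pair_bigA _
        (fun i j : 'I_k => if i < j then (G i j)`! else 1)) /=.
      by apply: eq_bigr => i _; rewrite big_mkcond.
    rewrite -(pair_bigA _
      (fun i j : 'I_k => if i == j then dfact (G i j) else 1)) /=.
    apply: eq_bigr => i _; rewrite (bigD1 i) //= eqxx big1 ?muln1 // => j.
    by rewrite eq_sym => /negbTE ->.
  apply: eq_bigr => -[i j] _ /=; rewrite /edge_mult /=.
  have [ij|ij|/val_inj <-] := ltngtP i j.
  - have ne : i != j by rewrite neq_ltn ij.
    by rewrite wE ?(ltnW ij) //= (negbTE ne) muln1 divn1.
  - have ne : i != j by rewrite neq_ltn ij orbT.
    by rewrite (negbTE ne).
  rewrite wE //= eqxx exp1n mul1n muln1 mulnC.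
  by rewrite -dfact_double -muln2 divnK // dvdn2.
apply/eqP; rewrite -(eqn_pmul2r Ppos) -mulnA DP mulnA cardf; apply/eqP.
by rewrite mulnAC.
Qed.

(** * Counting the permutations with a given contraction graph *)

Lemma half_ord_proof N (p : 'I_N.*2) : (p./2 < N)%N.
Proof. by rewrite ltn_half_double. Qed.

Definition half_ord N (p : 'I_N.*2) : 'I_N := Ordinal (half_ord_proof p).

(** Coordinates on the 2N index positions: the factor [l] and the side [b], [false] being the first
    index. *)
Definition Qslot N (l : 'I_N) (b : bool) : 'I_N.*2 :=
  if b then Qsnd l else Qfst l.

Lemma half_Qslot N (l : 'I_N) b : half_ord (Qslot l b) = l.
Proof. by apply: val_inj; case: b; rewrite /= ?uphalf_double ?doubleK. Qed.

Lemma odd_Qslot N (l : 'I_N) b : odd (Qslot l b) = b.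
Proof. by case: b; rewrite /= odd_double. Qed.

Lemma Qslot_half N (p : 'I_N.*2) : Qslot (half_ord p) (odd p) = p.
Proof.
apply: val_inj; rewrite -[RHS]odd_double_half /Qslot.
by case: (odd p).
Qed.

Lemma sum_Qslots N (F : 'I_N.*2 -> nat) :
  (\sum_p F p = \sum_(l < N) (F (Qfst l) + F (Qsnd l)))%N.
Proof.
rewrite (reindex (fun x : 'I_N * bool => Qslot x.1 x.2)) /=; last first.
  exists (fun p => (half_ord p, odd p)) => [[l b] _|p _] /=.
    by rewrite half_Qslot odd_Qslot.
  exact: Qslot_half.
rewrite -(pair_bigA _ (fun l b => F (Qslot l b))) /=; apply: eq_bigr => l _.
by rewrite big_bool addnC.
Qed.

Section Vertices.
Variables (k N : nat) (n : 'I_k -> nat) (hn : \sum_(i < k) n i = N.*2).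
Implicit Type f : {ffun 'I_N -> 'I_k * 'I_k}.

(** The word of [phi], through which [contraction_graph] factors. *)
Definition slot_pairs (phi : 'S_N.*2) : {ffun 'I_N -> 'I_k * 'I_k} :=
  [ffun l => (vertex hn phi (Qfst l), vertex hn phi (Qsnd l))].

(** A word read back as a labelling of the index positions by vertices. *)
Definition slot_vertex f (p : 'I_N.*2) : 'I_k :=
  if odd p then (f (half_ord p)).2 else (f (half_ord p)).1.

Lemma slot_vertex_fst f l : slot_vertex f (Qfst l) = (f l).1.
Proof.
by rewrite /slot_vertex -[Qfst l]/(Qslot l false) odd_Qslot half_Qslot.
Qed.

Lemma slot_vertex_snd f l : slot_vertex f (Qsnd l) = (f l).2.
Proof.
by rewrite /slot_vertex -[Qsnd l]/(Qslot l true) odd_Qslot half_Qslot.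
Qed.

Lemma slot_pairs_eq phi f :
  (slot_pairs phi == f) = [forall p, vertex hn phi p == slot_vertex f p].
Proof.
apply/eqP/forallP => [<- p|fp].
  rewrite /slot_vertex ffunE /= -{1}(Qslot_half p) /Qslot.
  by case: ifP => _; rewrite eqxx.
apply/ffunP => l; rewrite ffunE (eqP (fp _)) (eqP (fp _)).
by rewrite slot_vertex_fst slot_vertex_snd -surjective_pairing.
Qed.

Lemma card_slot_vertex f i :
  #|[pred p | slot_vertex f p == i]| = \sum_j pair_graph f i j.
Proof.
rewrite row_pair_graph -sum1_card big_mkcond sum_Qslots.
apply: eq_bigr => l _; rewrite !inE slot_vertex_fst slot_vertex_snd.
by congr (_ + _); case: eqP.
Qed.

Lemma contraction_graphE phi :
  contraction_graph hn phi = pair_graph (slot_pairs phi).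
Proof.
apply/matrixP => i j; rewrite !mxE; case: (eqVneq i j) => [<-|ij].
  congr (2 * _); rewrite cardsE; apply: eq_card => l.
  by rewrite !inE ffunE sort_pair_eq orbb.
rewrite mul1n cardsE; apply: eq_card => l.
by rewrite !inE ffunE sort_pair_eq.
Qed.

Lemma card_slot_tensor i :
  #|[pred s | tagnat.sig1 (cast_ord (esym hn) s) == i]| = n i.
Proof.
have slot_inj : injective (fun j : 'I_(n i) => cast_ord hn (tagnat.Rank i j)).
  by move=> j j' /cast_ord_inj /tagnat.rank_inj /eqP; rewrite eq_Tagged => /eqP.
rewrite -[RHS]card_ord -(fintype.card_image slot_inj).
apply: eq_card => s; rewrite inE; apply/eqP/fintype.imageP => [<-|[j _ ->]].
  exists (tagnat.sig2 (cast_ord (esym hn) s)) => //.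
  by rewrite tagnat.sig2K cast_ordKV.
by rewrite cast_ordK tagnat.Rank1K.
Qed.

Lemma card_vertex phi i : #|[pred p | vertex hn phi p == i]| = n i.
Proof.
rewrite -[RHS]card_slot_tensor -(fintype.card_image (@perm_inj _ phi^-1%g)).
apply: eq_card => s; rewrite [RHS]inE; apply/fintype.imageP/idP.
  by case=> p + ->; rewrite inE.
by move=> sp; exists (phi s); rewrite ?inE /vertex permK.
Qed.

(** Row [i] sums to the number of index positions at vertex [i], which [phi] matches with the [n i]
    slots of block [i]. *)
Lemma contraction_graph_multigraph phi :
  multigraphs n (contraction_graph hn phi).
Proof.
rewrite contraction_graphE; split=> [|i|i].
- by apply/matrixP => i j; rewrite !mxE eq_sym sort_pairC.
- by rewrite mxE eqxx mul2n odd_double.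
rewrite -card_slot_vertex -(card_vertex phi); apply: eq_card => p; rewrite !inE.
have /eqP := erefl (slot_pairs phi).
by rewrite slot_pairs_eq => /forallP/(_ p)/eqP ->.
Qed.

(** [phi] has word [f] exactly when its inverse intertwines [slot_vertex f] with the block map of
    the slots; the row sums give both maps fibres of size [n i]. *)
Lemma card_slot_pairs f : multigraphs n (pair_graph f) ->
  #|[set phi | slot_pairs phi == f]%SET| = \prod_i (n i)`!.
Proof.
case=> _ _ rowf.
have fib i : #|[pred p | slot_vertex f p == i]| = n i by rewrite card_slot_vertex.
rewrite -(eq_bigr _ (fun i _ => congr1 factorial (fib i))).
rewrite -(card_perm_intertwining
  (g := fun s => tagnat.sig1 (cast_ord (esym hn) s))).
  rewrite -(card_imset _ (@invg_inj _)); apply: eq_card => s.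
  rewrite inE; apply/finset.imsetP/idP => [[phi + ->]|fs].
    by rewrite inE slot_pairs_eq.
  by exists s^-1%g; rewrite ?invgK // inE slot_pairs_eq /vertex invgK.
by move=> i; rewrite fib card_slot_tensor.
Qed.

(** Permutations are grouped by their word: [card_pair_graph] counts the words, [card_slot_pairs]
    the permutations sharing one. *)
Lemma card_contraction_graph (G : 'M[nat]_k) : multigraphs n G ->
  #|[set phi | contraction_graph hn phi == G]%SET|
    * ((\prod_(i < k) \prod_(j < k | i < j) (G i j)`!) * \prod_(i < k) dfact (G i i))
  = (\prod_i (n i)`!) * (N`! * 2 ^ N).
Proof.
move=> GM; rewrite -(card_pair_graph GM hn) [RHS]mulnA; congr (_ * _).
rewrite -sum1dep_card.
rewrite (partition_big slot_pairs (fun f => pair_graph f == G)) /=; last first.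
  by move=> phi; rewrite contraction_graphE.
rewrite [RHS]mulnC -sum_nat_cond_const; apply: eq_bigr => f /eqP fG.
rewrite -(card_slot_pairs (f := f)) ?fG // -sum1dep_card.
apply: eq_bigl => phi; apply/andP/idP => [[] //|/eqP fphi]; split; last exact/eqP.
by rewrite contraction_graphE fphi fG.
Qed.

(** The number of preimages divides a positive product, so it is not zero. *)
Lemma exists_contraction_graph (G : 'M[nat]_k) : multigraphs n G ->
  exists phi, contraction_graph hn phi = G.
Proof.
move=> GM; have : 0 < (\prod_i (n i)`!) * (N`! * 2 ^ N).
  by rewrite !muln_gt0 fact_gt0 expn_gt0 prodn_gt0 // => i; apply: fact_gt0.
rewrite -(card_contraction_graph GM) muln_gt0 => /andP[/card_gt0P[phi] + _].
by rewrite inE => /eqP <-; exists phi.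
Qed.

Lemma multigraph_coefE (R : realType) (G : 'M[nat]_k) : multigraphs n G ->
  multigraph_coef R n G =
  ((N.*2`!)%:R^-1 * (#|[set phi | contraction_graph hn phi == G]%SET|)%:R)%R.
Proof.
move=> GM; have cardG := card_contraction_graph GM; rewrite /multigraph_coef hn.
set D := (X in (1 / X%:R)%R); rewrite -/D in cardG.
have Dpos : 0 < D.
  rewrite muln_gt0 !prodn_gt0 // => i; last first.
    by rewrite prodn_gt0 // => j; apply: fact_gt0.
  by have := fact_gt0 (G i i); rewrite fact_dfact muln_gt0 => /andP[].
have pos := fact_gt0 N.*2.
have dpos : 0 < dfact N.*2.-1.
  by move: pos; rewrite fact_dfact muln_gt0 => /andP[].
move: D Dpos cardG => D Dpos cardG.
have nz m : 0 < m -> (m%:R != 0 :> R)%R by rewrite pnatr_eq0 -lt0n.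
have dDpos : 0 < dfact N.*2.-1 * D by rewrite muln_gt0 dpos.
rewrite mul1r -mulrA -invfM -natrM -[RHS]mulrC.
apply/eqP; rewrite eqr_div ?nz // -!natrM eqr_nat; apply/eqP.
(* With denominators cleared, what remains is (2N)! = (2N)!! (2N-1)!! and (2N)!! = 2^N N!. *)
rewrite [RHS]mulnCA cardG fact_dfact dfact_double.
by rewrite [RHS]mulnC -[RHS]mulnA [N`! * _]mulnC.
Qed.

End Vertices.

Local Open Scope ring_scope.

(** * Contractions of symmetrized tensors *)

Section Symmetrization.
Variables (R : realType) (d : nat).
Local Notation tensor := (tensor R d).

Lemma reindex_permM m (s t : 'S_m) (nu : m.-tuple 'I_d) :
  Defs.reindex (s * t)%g nu = Defs.reindex s (Defs.reindex t nu).
Proof. by apply: eq_from_tnth => i; rewrite !tnth_mktuple permM. Qed.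

Lemma reindex_tuple_bij m (s : 'S_m) : bijective (@Defs.reindex d m s).
Proof.
exists (Defs.reindex s^-1%g) => nu; rewrite -reindex_permM ?mulVg ?mulgV;
  by apply: eq_from_tnth => i; rewrite tnth_mktuple perm1.
Qed.

(** Extends [t] to all [m + p] slots by fixing the first [m]. *)
Definition rshift_perm_fun m p (t : 'S_p) (i : 'I_(m + p)) : 'I_(m + p) :=
  match split i with inl j => lshift p j | inr j => rshift m (t j) end.

Lemma rshift_perm_inj m p (t : 'S_p) : injective (@rshift_perm_fun m p t).
Proof.
apply: (@can_inj _ _ _ (@rshift_perm_fun m p t^-1%g)) => i.
rewrite /rshift_perm_fun; case: (split_ordP i) => j ->.
  by rewrite (unsplitK (inl j)).
by rewrite (unsplitK (inr _)) permK.
Qed.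

Definition rshift_perm m p (t : 'S_p) : 'S_(m + p) :=
  perm (@rshift_perm_inj m p t).

Lemma rshift_perm_l m p (t : 'S_p) (j : 'I_m) :
  rshift_perm m t (lshift p j) = lshift p j.
Proof. by rewrite permE /rshift_perm_fun (unsplitK (inl j)). Qed.

Lemma rshift_perm_r m p (t : 'S_p) (j : 'I_p) :
  rshift_perm m t (rshift m j) = rshift m (t j).
Proof. by rewrite permE /rshift_perm_fun (unsplitK (inr j)). Qed.

(** Each inner permutation [t] extends to all slots and is absorbed by translation in the outer sum;
    the p! equal terms cancel the inner 1/p!. *)
Lemma vee_Symr m p (A : tensor m) (B : tensor p) : vee A (Defs.Sym B) = vee A B.
Proof.
apply/ffunP => nu; rewrite !ffunE; congr (_ * _).
transitivity (\sum_(s : 'S_(m + p)) \sum_(t : 'S_p)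
    (p`!)%:R^-1 * tens A B (Defs.reindex (rshift_perm m t * s)%g nu)).
  apply: eq_bigr => s _; rewrite -[RHS]mulr_sumr !ffunE mulrCA; congr (_ * _).
  rewrite mulr_sumr; apply: eq_bigr => t _.
  rewrite ffunE; congr (A _ * B _); apply: eq_from_tnth => i.
    by rewrite !tnth_mktuple permM rshift_perm_l.
  by rewrite !tnth_mktuple permM rshift_perm_r.
rewrite exchange_big /=.
transitivity (\sum_(t : 'S_p) (p`!)%:R^-1 *
    \sum_(s : 'S_(m + p)) tens A B (Defs.reindex s nu)).
  apply: eq_bigr => t _; rewrite -mulr_sumr; congr (_ * _).
  by rewrite [RHS](reindex_inj (mulgI (rshift_perm m t))).
rewrite sumr_const card_permT card_ord.
by rewrite -[LHS]mulr_natl mulrA mulfV ?mul1r // pnatr_eq0 -lt0n fact_gt0.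
Qed.

(** The ranks are only provably equal, so tensors are compared as pairs (rank, tensor), with [tcast]
    on the indices. *)
Lemma eq_gtensor m p (e : m = p) (X : tensor m) (Y : tensor p) :
  (forall nu, X nu = Y (tcast e nu)) -> Tagged tensor X = Tagged tensor Y.
Proof.
by case: p / e Y => Y XY; congr Tagged; apply/ffunP => nu; rewrite XY.
Qed.

(** By [tagnat.RankEsum] a block starts at the sum of the preceding lengths, so the later blocks are
    those of the tail shifted by [n ord0]. *)
Lemma tens_fam_recl k (n : 'I_k.+1 -> nat) (A : forall i, tensor (n i)) :
  Tagged tensor (tens_fam A) =
  Tagged tensor (tens (A ord0) (tens_fam (fun i => A (lift ord0 i)))).
Proof.
have e : (\sum_(i < k.+1) n i = n ord0 + \sum_(i < k) n (lift ord0 i))%N.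
  by rewrite big_ord_recl.
apply: (eq_gtensor (e := e)) => nu; rewrite !ffunE big_ord_recl.
congr (A ord0 _ * _).
  apply: eq_from_tnth => j; rewrite !tnth_mktuple tcastE; congr tnth.
  apply: val_inj; apply: (etrans (tagnat.RankEsum _)); rewrite -[RHS]add0n.
  by congr addn; apply: big_pred0.
apply: eq_bigr => i _; congr (A _ _).
apply: eq_from_tnth => j; rewrite !tnth_mktuple tcastE; congr tnth.
apply: val_inj; apply: (etrans (tagnat.RankEsum _)).
apply: (etrans _ (congr1 (addn (n ord0)) (esym (tagnat.RankEsum j)))).
rewrite addnA; congr addn.
by rewrite big_mkcond big_ord_recl /=; congr addn; rewrite [RHS]big_mkcond.
Qed.

Lemma Sym_cst m (c : R) : Defs.Sym [ffun=> c] = [ffun=> c] :> tensor m.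
Proof.
apply/ffunP => nu; rewrite !ffunE.
rewrite (eq_bigr (fun=> c)) => [|s _]; last by rewrite ffunE.
rewrite sumr_const card_permT card_ord -[c *+ _]mulr_natl mulrA mulVf ?mul1r //.
by rewrite pnatr_eq0 -lt0n fact_gt0.
Qed.

(** Acting on pairs, it can be applied to both sides of an equality between tensors of different
    rank expressions. *)
Definition Sym_gtensor (X : {m : nat & tensor m}) : {m : nat & tensor m} :=
  Tagged tensor (Defs.Sym (tagged X)).

(** The iterated product nests to the right, so removing the inner symmetrization of the right
    factor suffices. *)
Lemma gvee_famE k (n : 'I_k -> nat) (A : forall i, tensor (n i)) :
  gvee_fam A = Tagged tensor (Defs.Sym (tens_fam A)).
Proof.
rewrite /gvee_fam; elim: k n A => [|k IHk] n A.
  have e : (\sum_(i < 0) n i = 0)%N by rewrite big_ord0.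
  have E : Tagged tensor (tens_fam A) = gone R d.
    by apply: (eq_gtensor (e := e)) => nu; rewrite !ffunE big_ord0.
  rewrite big_ord0; apply: etrans (congr1 Sym_gtensor (esym E)).
  by rewrite /Sym_gtensor /= Sym_cst.
rewrite big_ord_recl IHk /gvee /= vee_Symr.
have := tens_fam_recl A => E.
exact: (congr1 Sym_gtensor (esym E)).
Qed.

Lemma tensor_cast_tagged m (X : {m : nat & tensor m}) (e : tag X = m)
    (Y : tensor m) :
  X = Tagged tensor Y -> tensor_cast e (tagged X) = Y.
Proof.
move=> XY; subst X; apply/ffunP => nu; rewrite ffunE /=.
by rewrite tcast_id.
Qed.

Lemma vee_famE k (n : 'I_k -> nat) (A : forall i, tensor (n i)) :
  vee_fam A = Defs.Sym (tens_fam A).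
Proof. by apply: tensor_cast_tagged; apply: gvee_famE. Qed.

Lemma tensor_cast_Sym m p (e : m = p) (A : tensor m) :
  tensor_cast e (Defs.Sym A) = Defs.Sym (tensor_cast e A).
Proof.
case: p / e; apply/ffunP => nu; rewrite !ffunE tcast_id.
by under [in RHS]eq_bigr do rewrite ffunE tcast_id.
Qed.

End Symmetrization.

(** * Full contraction as a mean over permutations, and invariance of the terms *)

Section Contraction.
Variables (R : realType) (d : nat) (Q : 'M[R]_d).
Local Notation tensor := (tensor R d).

(** [tau] contracts the first two slots, those of factor 0; the remaining factors are then shifted
    by one. *)
Lemma tau_iterE N (B : tensor N.*2) :
  scalar_of (tau_iter Q B) =
  \sum_(nu : N.*2.-tuple 'I_d)
    (\prod_(l < N) Q (tnth nu (Qfst l)) (tnth nu (Qsnd l))) * B nu.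
Proof.
elim: N B => [|N IHN] B.
  rewrite (big_pred1 [tuple]) => [|nu]; last by apply/esym/eqP/tuple0.
  by rewrite big_ord0 mul1r.
rewrite [tau_iter _ _]/(tau_iter Q (tau Q (B : tensor N.*2.+2))) IHN.
pose h (x : N.*2.-tuple 'I_d * ('I_d * 'I_d)) : N.+1.*2.-tuple 'I_d :=
  [tuple of x.2.1 :: x.2.2 :: x.1].
rewrite [RHS](reindex h) /=; last first.
  exists (fun nu : N.*2.+2.-tuple 'I_d =>
    ([tuple of behead (behead nu)], (thead nu, thead [tuple of behead nu]))).
    move=> [nu [a b]] _ /=; congr (_, (_, _)); first exact: val_inj.
  move=> nu _; case/tupleP: nu => a nu; case/tupleP: nu => b nu.
  by apply: val_inj.
rewrite -(pair_bigA _ (fun nu (ab : 'I_d * 'I_d) =>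
  (\prod_(l < N.+1)
     Q (tnth (h (nu, ab)) (Qfst l)) (tnth (h (nu, ab)) (Qsnd l))) *
  B (h (nu, ab)))) /=.
apply: eq_bigr => nu _; rewrite ffunE.
rewrite (pair_bigA _ (fun a b => Q a b * B [tuple of a :: b :: nu])) mulr_sumr.
apply: eq_bigr => -[a b] _ /=; rewrite big_ord_recl mulrA; congr (_ * _).
rewrite mulrC; congr (_ * _); apply: eq_bigr => l _.
by rewrite !(tnth_nth a).
Qed.

Lemma contraction_mean k N (n : 'I_k -> nat) (hn : (\sum_(i < k) n i)%N = N.*2)
    (A : forall i, tensor (n i)) :
  scalar_of (tau_iter Q (tensor_cast hn (vee_fam A))) =
  (N.*2`!)%:R^-1 * \sum_(s : 'S_N.*2) contraction Q hn A s.
Proof.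
rewrite vee_famE tensor_cast_Sym tau_iterE exchange_big mulr_sumr /=.
apply: eq_bigr => nu _; rewrite ffunE -mulr_sumr.
by rewrite mulrCA.
Qed.

(** Only the block receiving each index matters, since its position inside the block is irrelevant
    to a symmetric tensor. *)
Lemma eq_vertex_contraction k N (n : 'I_k -> nat)
    (hn : (\sum_(i < k) n i)%N = N.*2) (A : forall i, tensor (n i))
    (hA : forall i, symmetric_tensor (A i)) (phi psi : 'S_N.*2) :
  (forall p, vertex hn phi p = vertex hn psi p) ->
  contraction Q hn A phi = contraction Q hn A psi.
Proof.
move=> phipsi; apply: eq_bigr => nu _; congr (_ * _); rewrite !ffunE.
apply: eq_bigr => i _.
(* psi^-1 phi preserves every block of slots; f is its restriction to block i. *)
pose r j := cast_ord hn (tagnat.Rank i j).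
(* [c j] is the slot as a pair (block, position); [c1] puts its position in the type of positions of
   block [i]. *)
pose c j := tagnat.sig (cast_ord (esym hn) ((psi^-1)%g (phi (r j)))).
have c1 j : tag (c j) = i.
  have := phipsi (phi (r j)).
  by rewrite /vertex permK cast_ordK tagnat.Rank1K => /esym.
pose f j := etagged (c1 j).
have fE j : psi (r (f j)) = phi (r j).
  have rE : tagnat.Rank i (f j) =
            cast_ord (esym hn) ((psi^-1)%g (phi (r j))).
    rewrite -[RHS]tagnat.sigK -/(c j) /f /tagnat.Rank; congr tagnat.rank.
    by case: _ / (c1 j); rewrite taggedK.
  by rewrite {1}/r rE cast_ordKV permKV.
have f_inj : injective f.
  move=> j j' fj; have := fE j; rewrite fj fE => /perm_inj /cast_ord_inj.
  by move=> /tagnat.rank_inj /eqP; rewrite eq_Tagged => /eqP.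
rewrite -[RHS](hA i (perm f_inj)); congr (A i _).
apply: eq_from_tnth => j; rewrite !tnth_mktuple !tcastE !tnth_mktuple.
by rewrite permE !esymK fE.
Qed.
End Contraction.

(** Equal graphs mean words with the same multiset of edges. Reordering the factors and swapping the
    two indices of a factor turns one word into the other, and the product of the symmetric [Q] is
    invariant under both. *)
Lemma contraction_graph_eq (R : realType) (d : nat) (Q : 'M[R]_d) (hQ : Q^T = Q)
    (k N : nat) (n : 'I_k -> nat) (hn : (\sum_(i < k) n i)%N = N.*2)
    (A : forall i : 'I_k, tensor R d (n i))
    (hA : forall i : 'I_k, symmetric_tensor (A i)) (phi psi : 'S_N.*2) :
  contraction_graph hn phi = contraction_graph hn psi ->
  contraction Q hn A phi = contraction Q hn A psi.
Proof.
have GM := contraction_graph_multigraph hn psi.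
move=> phipsi.
(* The two words agree up to the permutation s of the letters and the
   exchange of the components of the letters l with e l. *)
have [s sE] : exists s : 'S_N, forall l,
    sort_pair (slot_pairs hn psi (s l)) = sort_pair (slot_pairs hn phi l).
  apply: (exists_perm_intertwining (f := fun l => sort_pair (slot_pairs hn phi l))
    (g := fun l => sort_pair (slot_pairs hn psi l))) => x.
  have := pair_graphP (slot_pairs hn psi) GM.
  rewrite -contraction_graphE eqxx => /esym/forallP/(_ x)/eqP ->.
  have := pair_graphP (slot_pairs hn phi) GM.
  by rewrite -contraction_graphE phipsi eqxx => /esym/forallP/(_ x)/eqP ->.
pose e l := slot_pairs hn psi (s l) != slot_pairs hn phi l.
(* Factor [l] goes to factor [s l], its two sides exchanged exactly when [e l] holds. *)
pose h p := Qslot (s (half_ord p)) (odd p (+) e (half_ord p)).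
have h_inj : injective h.
  move=> p q hpq; have := congr1 (@half_ord N) hpq.
  rewrite !half_Qslot => /perm_inj pq.
  have := congr1 (fun p : 'I_N.*2 => odd p) hpq; rewrite /h !odd_Qslot pq.
  by move=> /addIb o; rewrite -(Qslot_half p) -(Qslot_half q) pq o.
pose pi := perm h_inj.
have piE l b : pi (Qslot l b) = Qslot (s l) (b (+) e l).
  by rewrite permE /h half_Qslot odd_Qslot.
have vE p : vertex hn psi (pi p) = vertex hn phi p.
  rewrite -(Qslot_half p) piE; move: (half_ord p) (odd p) => l b.
  have := sE l; rewrite /e !ffunE /Qslot => /eqP.
  rewrite sort_pair_eq xpair_eqE => /orP[]/andP[/eqP E1 /eqP E2]; rewrite E1 E2.
    by rewrite !eqxx addbF; case: b; rewrite ?E1 ?E2.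
  (* For a loop the crossed matching is also the straight one, and [e l] is false. *)
  have [E|_] := eqVneq (vertex hn phi (Qfst l)) (vertex hn phi (Qsnd l)).
    by rewrite addbF; case: b; rewrite ?E1 ?E2 ?E.
  by rewrite addbT; case: b; rewrite ?E1 ?E2.
(* Moving the index positions by [pi] gives [psi] the vertices of [phi]; renaming the summed indices
   by [pi] then undoes the move. *)
transitivity (contraction Q hn A (psi * pi^-1)%g).
  apply: eq_vertex_contraction => // p.
  by rewrite -vE /vertex invMg invgK permM.
rewrite /contraction (reindex (Defs.reindex pi)); last first.
  exact/onW_bij/reindex_tuple_bij.
apply: eq_bigr => nu _; rewrite -reindex_permM mulgKV; congr (_ * _).
rewrite [RHS](reindex_inj (@perm_inj _ s)); apply: eq_bigr => l _.
rewrite !tnth_mktuple -[Qfst l]/(Qslot l false) -[Qsnd l]/(Qslot l true) !piE.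
by case: (e l) => //=; rewrite -[in LHS]hQ mxE.
Qed.

(** The arbitrary choice of representatives is a section [phi] of H over the multigraphs; the first
    conjunct ensures that such a choice is possible. *)
Theorem lemma2p1 (R : realType) (d : nat) (Q : 'M[R]_d) (hQ : Q^T = Q)
    (k N : nat) (n : 'I_k -> nat) (hn : (\sum_(i < k) n i)%N = N.*2)
    (A : forall i : 'I_k, tensor R d (n i))
    (hA : forall i : 'I_k, symmetric_tensor (A i)) :
  (forall G, multigraphs n G -> exists phi : 'S_(N.*2), contraction_graph hn phi = G) /\
  (forall phi : 'M[nat]_k -> 'S_(N.*2),
     (forall G, multigraphs n G -> contraction_graph hn (phi G) = G) ->
     scalar_of (tau_iter Q (tensor_cast hn (vee_fam A))) =
     \sum_(G \in multigraphs n) multigraph_coef R n G * contraction Q hn A (phi G)).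
Proof.
split=> [G|phi phiG]; first exact: exists_contraction_graph.
have finG := finite_multigraphs n.
rewrite contraction_mean fsbig_finite //= mulr_sumr.
(* Group the permutations by their graph; each one is met once, since its graph is a multigraph of
   the right degrees. *)
transitivity (\sum_(G <- fset_set (multigraphs n))
    \sum_(s | contraction_graph hn s == G) (N.*2`!)%:R^-1 * contraction Q hn A s).
  rewrite (exchange_big_dep predT) //=; apply: eq_bigr => s _.
  rewrite big_const_seq (eq_count (a2 := pred1 (contraction_graph hn s))).
    rewrite count_uniq_mem ?fset_uniq // in_fset_set // mem_set /= ?addr0 //.
    exact: contraction_graph_multigraph.
  by move=> G /=; rewrite eq_sym.
rewrite big_seq [RHS]big_seq; apply: eq_bigr => G.
rewrite in_fset_set // => /set_mem GM.
(* The contraction is constant on each fibre of H, so the fibre contributes its cardinal, which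
   [multigraph_coefE] turns into the coefficient. *)
rewrite (eq_bigr (fun=> (N.*2`!)%:R^-1 * contraction Q hn A (phi G))).
  by rewrite sumr_const (multigraph_coefE hn _ GM) -mulrnAl mulr_natr cardsE.
move=> s /eqP sG; congr (_ * _); apply: (contraction_graph_eq hQ hA).
by rewrite sG phiG.
Qed.
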